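(* Let $f=(\alpha_1\alpha_2\cdots\alpha_n)$ be an $n$-player rule, and let $m<n$ be a positive integer such that $\mathrm{ord}_fP\leqslant m$ for every $P\in\mathcal{L}$. Let $g=(\alpha_1\alpha_2\cdots\alpha_m)$ be the $m$-player rule. Then $f\sim g$, i.e. $\mathrm{ord}_fP=\mathrm{ord}_gP$ for all $P\in\mathcal{L}$.
   Context: Positions are finite tuples $P=(a_1,\dots,a_k)$ of integers with $a_1\geqslant\dots\geqslant a_k\geqslant0$, where tuples differing only by trailing zeros are identified. $(0)$ is the empty position, $\mathcal{L}$ is the set of positions other than $(0)$, and $|P|=\sum a_i$ is the volume of $P$. A chomp move $P\to Q$ from $P=(a_1,\dots,a_k)$ chooses $1\leqslant x\leqslant k$ and an integer $a\geqslant0$, and sets $Q=(b_1,\dots,b_k)$ with $b_j=a_j$ for $j<x$ and $b_j=\min(a_j,a)$ for $j\geqslant x$, where $Q$ must be a different position from $P$. Write $\mathrm{Mov}P=\{Q:P\to Q\}$. An $n$-player rule ($n\geqslant1$) is a tuple $f=(\alpha_1\cdots\alpha_n)$ of distinct real numbers. Ordinals $\mathrm{ord}_f$ are defined recursively on volume as follows. - $\mathrm{ord}_f(0)=0$. - For a position $Q$, set $s_f(Q)=\alpha_{\mathrm{ord}_fQ+1}$ if $\mathrm{ord}_fQ<n$ and $s_f(Q)=\alpha_1$ if $\mathrm{ord}_fQ=n$. - For $P\in\mathcal{L}$, $\mathrm{ord}_fP$ is the unique $i\in\{1,\dots,n\}$ with $\alpha_i=\max_{Q\in\mathrm{Mov}P}s_f(Q)$.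 Two rules $f,g$ (possibly with different numbers of players) are isomorphic, written $f\sim g$, if $\mathrm{ord}_fP=\mathrm{ord}_gP$ for all $P\in\mathcal{L}$. *)

(* Defs.v *)
From HB Require Import structures.
From mathcomp Require Import all_boot all_order all_algebra.
From mathcomp Require Import reals.

Set Implicit Arguments.
Unset Strict Implicit.
Unset Printing Implicit Defensive.

Import Order.TTheory GRing.Theory Num.Theory.

(* A nonincreasing tuple of naturals, up to trailing zeros, is represented by
   its unique representative without zero entries. *)
Definition is_position (s : seq nat) : bool := sorted geq s && (0 \notin s).

Record position := Position { rows :> seq nat; _ : is_position rows }.

HB.instance Definition _ := [isSub for rows].
HB.instance Definition _ := [Equality of position by <:].

Definition empty_position : position := @Position [::] isT.

Definition volume (P : position) : nat := sumn P.

(* In a nonincreasing tuple all zeros are trailing, so filtering them out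
   yields the representative. *)
Definition trim (s : seq nat) : seq nat := [seq a <- s | a != 0].

Lemma trim_is_position (s : seq nat) : sorted geq s -> is_position (trim s).
Proof.
move=> s_sorted; apply/andP; split; last by rewrite mem_filter eqxx.
by apply: sorted_filter => // y x z /= yx zy; apply: leq_trans zy yx.
Qed.

(* Indices start at 0, so x here is x - 1 of the informal convention. *)
Definition chomp_seq (s : seq nat) (x a : nat) : seq nat :=
  mkseq (fun j => if j < x then nth 0 s j else minn (nth 0 s j) a) (size s).

Lemma chomp_seq_sorted (s : seq nat) (x a : nat) :
  sorted geq s -> sorted geq (chomp_seq s x a).
Proof.
move=> s_sorted; apply/(sortedP 0) => i; rewrite size_mkseq => i_lt.
have /(sortedP 0)/(_ i i_lt) /= le_s := s_sorted.
rewrite !nth_mkseq //; last exact: ltnW.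
case: (ltnP i.+1 x) => [ix|xi]; first by rewrite (ltnW ix).
case: ltnP => [ix|xi']; first by rewrite (leq_trans (geq_minl _ _)).
by rewrite leq_min geq_minr andbT (leq_trans (geq_minl _ _)).
Qed.

Lemma rows_sorted (P : position) : sorted geq P.
Proof. by case: P => s /= /andP[]. Qed.

Definition chomp (P : position) (x a : nat) : position :=
  Position (trim_is_position (chomp_seq_sorted x a (rows_sorted P))).

Definition chomp_move (P Q : position) : Prop :=
  exists x a : nat, [/\ x < size P, Q = chomp P x a & Q <> P].

(* Bounding a by the first row loses nothing: see MovP. *)
Definition Mov (P : position) : seq position :=
  [seq Q <- [seq chomp P x a | x <- iota 0 (size P), a <- iota 0 (head 0 P).+1]
     | Q != P].

Lemma MovP (P Q : position) : reflect (chomp_move P Q) (Q \in Mov P).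
Proof.
rewrite mem_filter; apply: (iffP andP) => [[/eqP QP /allpairsP[[x a]]]|].
  by rewrite !mem_iota !add0n /= => -[xP _ QE]; exists x, a.
case=> x [a [xP QE /eqP QP]]; split=> //.
apply/allpairsP; exists (x, minn a (head 0 P)).
split; rewrite ?mem_iota ?add0n ?ltnS ?geq_minr //=.
rewrite QE; apply: val_inj => /=; congr trim.
apply: (@eq_from_nth _ 0); rewrite !size_mkseq // => i iP.
rewrite !nth_mkseq //; case: ltnP => // _.
rewrite (minnC a) minnA; congr minn; apply/esym/minn_idPl.
have geq_trans : transitive geq by move=> y u z /= yu zy; apply: leq_trans zy yu.
rewrite -nth0; apply: (sorted_leq_nth geq_trans leqnn 0 (rows_sorted P)) => //.
by rewrite inE (leq_ltn_trans _ iP).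
Qed.

Lemma empty_in_Mov (P : position) :
  P != empty_position -> empty_position \in Mov P.
Proof.
move=> P0; apply/MovP; exists 0, 0; split; last first.
- by move/eqP; rewrite eq_sym (negPf P0).
- apply: val_inj => /=; symmetry.
  rewrite /trim /chomp_seq; under eq_mkseq do rewrite minn0.
  by rewrite /mkseq; elim: (iota _ _).
- rewrite lt0n; apply: contraNneq P0 => /size0nil P0; exact/eqP/val_inj.
Qed.

Lemma volume_Mov (P Q : position) : Q \in Mov P -> volume Q < volume P.
Proof.
move/MovP=> [x [a [_ -> /eqP QP]]].
have sumn_trim (s : seq nat) : sumn (trim s) = sumn s.
  by elim: s => //= -[|b] s /= ->.
rewrite /volume /= sumn_trim.
have {}QP : chomp_seq P x a != P.
  apply: contraNneq QP => E; apply/eqP/val_inj; rewrite /= E.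
  case: (P) => s /= /andP[_ s0]; apply/all_filterP/allP => b bs.
  by apply: contraNneq s0 => <-.
have le_nth j : (if j < x then nth 0 P j else minn (nth 0 P j) a) <= nth 0 P j.
  by case: ifP => // _; exact: geq_minl.
have sumn_lt (F G : nat -> nat) (r : seq nat) : (forall j, F j <= G j) ->
    map F r != map G r -> sumn (map F r) < sumn (map G r).
  move=> FG; have le_sum q : sumn (map F q) <= sumn (map G q).
    by elim: q => //= j q IH; rewrite leq_add.
  elim: r => //= j r IH; rewrite eqseq_cons negb_and.
  case: (eqVneq (F j) (G j)) => [-> /=|neq _]; first by rewrite ltn_add2l.
  by rewrite -addSn leq_add // ltn_neqAle neq FG.
rewrite -[X in _ < sumn X](mkseq_nth 0 P); apply: sumn_lt => //.
by rewrite -/(mkseq _ _) -/(mkseq _ _) mkseq_nth.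
Qed.

Local Open Scope ring_scope.

Record rule (R : realType) (n : nat) :=
  Rule { payoffs :> n.-tuple R; _ : (0 < n)%N && uniq payoffs }.

Lemma truncate_subproof (R : realType) (n m : nat) (f : rule R n)
    (m_gt0 : (0 < m)%N) (le_mn : (m <= n)%N) :
  (0 < m)%N && uniq [tuple tnth f (widen_ord le_mn i) | i < m].
Proof.
rewrite m_gt0 /= map_inj_uniq ?enum_uniq //; case: f => f /= /andP[_ f_uniq].
by move=> i j /(tuple_uniqP _ f_uniq) /(congr1 val) /= ij; apply: val_inj.
Qed.

Definition truncate (R : realType) (n m : nat) (f : rule R n)
    (m_gt0 : (0 < m)%N) (le_mn : (m <= n)%N) : rule R m :=
  Rule (truncate_subproof f m_gt0 le_mn).

Definition seq_max (R : realType) (s : seq R) : R :=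
  \big[Num.max/head 0 s]_(x <- s) x.

(* alpha_(i+1) if i < n and alpha_1 otherwise; f`_i is alpha_(i+1). *)
Definition next_payoff (R : realType) (n : nat) (f : rule R n) (i : nat) : R :=
  if (i < n)%N then f`_i else f`_0.

(* k is fuel; the recursion on volume is recovered in ord_spec. *)
Fixpoint ord_rec (R : realType) (n : nat) (f : rule R n) (k : nat)
    (P : position) : nat :=
  if P == empty_position then 0%N else
  if k is k'.+1 then
    (index (seq_max [seq next_payoff f (ord_rec f k' Q) | Q <- Mov P]) f).+1
  else 0%N.

Definition ord (R : realType) (n : nat) (f : rule R n) (P : position) : nat :=
  ord_rec f (volume P) P.

Definition score (R : realType) (n : nat) (f : rule R n) (Q : position) : R :=
  next_payoff f (ord f Q).

Definition isomorphic (R : realType) (n m : nat) (f : rule R n) (g : rule R m)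
    : Prop :=
  forall P : position, P != empty_position -> ord f P = ord g P.

Lemma seq_maxP (R : realType) (s : seq R) : s != [::] ->
  seq_max s \in s /\ {in s, forall x, x <= seq_max s}.
Proof.
rewrite /seq_max => s_neq0; split; last by move=> x xs; exact: le_bigmax_seq.
have := mem_head (head 0 s) (behead s).
have -> : head 0 s :: behead s = s by case: s s_neq0.
move=> s_head; rewrite big_seq; elim/big_ind: _ => // a b ha hb.
by rewrite maxEle; case: ifP.
Qed.

Lemma ord_empty (R : realType) (n : nat) (f : rule R n) :
  ord f empty_position = 0%N.
Proof. by []. Qed.

Lemma ord_rec_fuel (R : realType) (n : nat) (f : rule R n) (k : nat)
    (P : position) :
  (volume P <= k)%N -> ord_rec f k P = ord f P.
Proof.
suff fuel l : (volume P <= k)%N -> (volume P <= l)%N ->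
    ord_rec f k P = ord_rec f l P by move=> Pk; exact: fuel.
elim: k l P => [|k IH] [|l] P Pk Pl //=; case: (eqVneq P empty_position) => // P0.
- by have := leq_trans (volume_Mov (empty_in_Mov P0)) Pk.
- by have := leq_trans (volume_Mov (empty_in_Mov P0)) Pl.
- congr (index (seq_max _) _).+1; apply/eq_in_map => Q /volume_Mov QP.
  by rewrite (IH l) // -ltnS (leq_trans QP).
Qed.

Lemma ord_spec (R : realType) (n : nat) (f : rule R n) (P : position) :
  P != empty_position ->
  [/\ (0 < ord f P)%N, (ord f P <= n)%N &
      f`_(ord f P).-1 = seq_max [seq score f Q | Q <- Mov P]].
Proof.
move=> P0; have PV := volume_Mov (empty_in_Mov P0).
have ordE : ord f P = (index (seq_max [seq score f Q | Q <- Mov P]) f).+1.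
  rewrite {1}/ord; case E: (volume P) PV => [//|k] _ /=; rewrite (negPf P0).
  congr (index (seq_max _) _).+1; apply/eq_in_map => Q /volume_Mov QP.
  by rewrite ord_rec_fuel // -ltnS -E.
have n_gt0 : (0 < n)%N by case: (f) => ? /= /andP[].
have maxf : seq_max [seq score f Q | Q <- Mov P] \in (f : seq R).
  have [|+ _] := @seq_maxP _ [seq score f Q | Q <- Mov P].
    by case: (Mov P) (empty_in_Mov P0).
  case/mapP => Q _ ->; rewrite /score /next_payoff.
  by case: ifP => ?; rewrite mem_nth // size_tuple.
rewrite ordE; split=> //=; last exact: nth_index.
by move: maxf; rewrite -index_mem size_tuple.
Qed.

(* Main.v *)
(** By induction on the volume, [ord f] and [ord g] agree on the moves [Q] of
    [P], where [g] is the truncation; the scores of [Q] can then differ only if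
    [ord f Q = m], where they are alpha_(m+1) for [f] and alpha_1 for [g].
    Neither difference affects the maximum: alpha_1 is already the score of the
    empty position, which is always reachable, and alpha_(m+1) is never the
    maximum for [f], since otherwise [ord f P = m + 1]. *)
Require Import Defs.
From mathcomp Require Import all_boot all_order all_algebra.
From mathcomp Require Import reals.

Import Order.TTheory.

Lemma nth_payoffs_inj (R : realType) (n : nat) (f : rule R n) (i j : nat) :
  i < n -> j < n -> (f`_i = f`_j)%R -> i = j.
Proof.
case: f => f /= /andP[_ f_uniq] i_lt j_lt /eqP.
by rewrite nth_uniq ?size_tuple // => /eqP.
Qed.

Lemma nth_truncate (R : realType) (n m : nat) (f : rule R n)
    (m_gt0 : 0 < m) (le_mn : m <= n) (i : nat) :
  i < m -> ((truncate f m_gt0 le_mn)`_i = f`_i)%R.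
Proof.
move=> i_lt; rewrite -[i]/(val (Ordinal i_lt)) -tnth_nth tnth_mktuple.
by rewrite (tnth_nth 0%R).
Qed.

Lemma seq_max_unique (R : realType) (s : seq R) (x : R) :
  x \in s -> {in s, forall y, (y <= x)%R} -> seq_max s = x.
Proof.
move=> xs ub; have s0 : s != [::] by case: s xs {ub}.
by have [ms le_m] := seq_maxP s0; apply/le_anti; rewrite ub // le_m.
Qed.

Theorem theorem3p5 (R : realType) (n m : nat) (f : rule R n)
    (m_gt0 : 0 < m) (m_lt_n : m < n)
    (ord_le_m : forall P : position, P != empty_position -> ord f P <= m) :
  isomorphic f (truncate f m_gt0 (ltnW m_lt_n)).
Proof.
set g := truncate _ _ _ => P.
have [k] := ubnP (volume P); elim: k P => // k IH P; rewrite ltnS => Pk P0.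
have [f_gt0 _ f_max] := ord_spec f P0.
have [g_gt0 g_le g_max] := ord_spec g P0.
have f_le := ord_le_m P P0.
have predf : (ord f P).-1 < m by rewrite prednK.
have predg : (ord g P).-1 < m by rewrite prednK.
(* The induction hypothesis and [ord_le_m] exclude the empty position, where both ordinals are 0. *)
have ordQ Q : Q \in Mov P -> ord f Q = ord g Q /\ ord f Q <= m.
  move=> QP; have [->|Q0] := eqVneq Q empty_position; first by rewrite !ord_empty.
  by split; [apply: IH => //; exact: leq_trans (volume_Mov QP) Pk | exact: ord_le_m].
have scoreQ Q : Q \in Mov P -> ord f Q < m -> score g Q = score f Q.
  move=> QP Qm; have [e _] := ordQ Q QP.
  by rewrite /score /next_payoff -e Qm (ltn_trans Qm m_lt_n) nth_truncate.
have E0 := empty_in_Mov P0.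
have [|f_in f_ub] := @seq_maxP _ [seq score f Q | Q <- Mov P].
  by case: (Mov P) E0.
rewrite -f_max in f_in f_ub.
have g_maxE : seq_max [seq score g Q | Q <- Mov P] = (f`_(ord f P).-1)%R.
  apply: seq_max_unique.
    case/mapP: f_in => Q QP fQ; apply/mapP; exists Q => //.
    have [_] := ordQ Q QP; rewrite leq_eqVlt => /orP[/eqP Qm|Qm]; last first.
      by rewrite scoreQ.
    (* Since [m < n], [f] does not wrap around at [Q]: its score is the entry of index [m].
       Distinctness of the payoffs would force [(ord f P).-1 = m], against [predf]. *)
    move: fQ; rewrite /score /next_payoff Qm m_lt_n => /nth_payoffs_inj e.
    by move: (predf); rewrite e ?ltnn // (ltn_trans predf).
  move=> _ /mapP[Q QP ->].
  have [e] := ordQ Q QP; rewrite leq_eqVlt => /orP[/eqP Qm|Qm]; last first.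
    by rewrite scoreQ // f_ub // map_f.
  (* Here [g] wraps around to its first payoff, which [f] already scores at the empty position. *)
  rewrite {1}/score /next_payoff -e Qm ltnn nth_truncate //.
  have := f_ub _ (map_f (score f) E0).
  by rewrite /score /next_payoff ord_empty (ltn_trans m_gt0 m_lt_n).
(* Both predecessors are below [m], so they can be compared as indices into [g]. *)
rewrite -(prednK f_gt0) -(prednK g_gt0); congr _.+1.
by apply: (nth_payoffs_inj _ _ g) => //; rewrite g_max g_maxE nth_truncate.
Qed.
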